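(* Let $V$ be a finite set with $|V|\ge 2$ and let $\mathcal{P}=(P_t)_{t\ge1}$ be a sequence of irreducible and reversible transition matrices on $V$ which all have the same stationary distribution $\pi$. Let $(X_t)_{t\ge0}$ be a random walk according to $\mathcal{P}$ such that $X_0$ is sampled from $\pi$. Then, for any vertex $w\in V$ and any integer $T\ge0$, $$\Pr\left[\bigwedge_{t=0}^T\{X_t\ne w\}\right]\le\prod_{t=1}^T\left(1-\frac{1}{t_{\mathrm{hit}}(P_t)}\right)\le\exp\left(-\frac{T}{t_{\mathrm{HIT}}(\mathcal{P})}\right).$$
   Context: A transition matrix $P\in[0,1]^{V\times V}$ is a row-stochastic matrix. It is irreducible if for all $u,v$ there is $t>0$ with $P^t(u,v)>0$; reversible if $\pi(u)P(u,v)=\pi(v)P(v,u)$ for all $u,v$, where $\pi$ is its stationary distribution. A random walk according to $\mathcal{P}$ is a time-inhomogeneous Markov chain $(X_t)_{t\ge0}$ with $\Pr[X_t=v\mid X_{t-1}=u]=P_t(u,v)$ for $t\ge1$. $t_{\mathrm{hit}}(P)=\max_{u,w\in V}\mathbf{E}[\min\{t\ge 0:Y_t=w\}\mid Y_0=u]$ for the time-homogeneous chain $(Y_t)$ with transition matrix $P$; $t_{\mathrm{HIT}}(\mathcal{P})=\max_{t\ge 1}t_{\mathrm{hit}}(P_t)$ (read as a supremum, assumed finite). *)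

(* Defs.v *)
From HB Require Import structures.
From mathcomp Require Import all_boot all_order all_algebra.
From mathcomp Require Import all_classical all_reals all_analysis.
From mathcomp Require Import measurable_realfun.

Set Implicit Arguments.
Unset Strict Implicit.
Unset Printing Implicit Defensive.

Import Order.TTheory GRing.Theory Num.Theory.
Import numFieldNormedType.Exports.

Local Open Scope classical_set_scope.
Local Open Scope ring_scope.

Section Matrices.
Context {R : realType} {V : finType}.
Implicit Types (P : V -> V -> R) (pi : V -> R).

Definition transition_matrix P : Prop :=
  (forall u v, 0 <= P u v <= 1) /\ (forall u, \sum_(v : V) P u v = 1).

Fixpoint mpow P (t : nat) (u v : V) : R :=
  if t is s.+1 then \sum_(z : V) P u z * mpow P s z v else (u == v)%:R.

Definition irreducible P : Prop :=
  forall u v, exists2 t : nat, (0 < t)%N & 0 < mpow P t u v.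

Definition stationary pi P : Prop :=
  [/\ forall v, 0 <= pi v, \sum_(v : V) pi v = 1 &
      forall v, \sum_(u : V) pi u * P u v = pi v].

Definition reversible pi P : Prop :=
  forall u v, pi u * P u v = pi v * P v u.

End Matrices.

Section RandomWalk.
Context {R : realType} {V : finType} {d : measure_display}
  {Omega : measurableType d}.
Variable Pr : probability Omega R.
Implicit Types (X : nat -> Omega -> V) (y : nat -> V).

Definition cprob (A B : set Omega) : R := fine (Pr (A `&` B)) / fine (Pr B).

Definition history X y (t : nat) : set Omega :=
  [set omega | forall s, (s <= t)%N -> X s omega = y s].

(* Step t.+1 uses P t.+1, so P 0 plays no role. Conditioning on the whole
   history up to time t expresses both the Markov property and the transition
   probabilities. *)
Definition random_walk (P : nat -> V -> V -> R) X : Prop :=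
  (forall t v, measurable (X t @^-1` [set v])) /\
  (forall t y, Pr (history X y t) != 0%E ->
     cprob (X t.+1 @^-1` [set y t.+1]) (history X y t)
     = P t.+1 (y t) (y t.+1)).

End RandomWalk.

(* min {t >= 0 : Y_t = w}, equal to +oo if w is never visited. *)
Definition hitting_time {R : realType} {V : finType} {Omega : Type}
    (Y : nat -> Omega -> V) (w : V) (omega : Omega) : \bar R :=
  ereal_inf [set t%:R%:E | t in [set t : nat | Y t omega = w]].

Section Hitting.
Context {R : realType} {V : finType}.
Variable P : V -> V -> R.

(* The time-homogeneous chain with transition matrix P started at u, realised
   on R with the uniform distribution on [0, 1]. In state (u, x), the next
   vertex is the v such that x lies in the v-th interval of the partition of
   [0, 1[ into consecutive intervals of lengths P u v, and the position of x
   within this interval, rescaled to [0, 1[, drives the following steps.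
   Lemma chain_random_walk below shows that this is a random walk. *)
Definition cumul (u v : V) : R :=
  \sum_(z : V | (enum_rank z < enum_rank v)%N) P u z.

Definition jump (s : V * R) : V * R :=
  if [pick v | cumul s.1 v <= s.2 < cumul s.1 v + P s.1 v] is Some v
  then (v, (s.2 - cumul s.1 v) / P s.1 v) else s.

Definition chain (u : V) (t : nat) (x : R) : V := (iter t jump (u, x)).1.

Definition expected_hit (u w : V) : \bar R :=
  (\int[uniform_prob (@ltr01 R)]_x hitting_time (chain u) w x)%E.

Definition t_hit : \bar R :=
  (\big[maxe/-oo]_(u : V) \big[maxe/-oo]_(w : V) expected_hit u w)%E.

End Hitting.

Definition t_HIT {R : realType} {V : finType} (P : nat -> V -> V -> R) :
    \bar R :=
  ereal_sup [set t_hit (P t) | t in [set t : nat | (1 <= t)%N]].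

Section ChainIsRandomWalk.
Context {R : realType} {V : finType}.
Variable P : V -> V -> R.
Hypothesis tP : transition_matrix P.

Let P0 u v : 0 <= P u v. Proof. by have /andP[] := tP.1 u v. Qed.

Let cumul0 u v : 0 <= cumul P u v. Proof. exact: sumr_ge0. Qed.

Let cumul_lt u (v z : V) : (enum_rank v < enum_rank z)%N ->
  cumul P u v + P u v <= cumul P u z.
Proof.
move=> vz; rewrite /cumul [leRHS](bigD1 v)//= [leRHS]addrC lerD2r.
rewrite [leRHS](bigID (fun i => (enum_rank i < enum_rank v)%N))/=.
rewrite [X in _ <= X + _](eq_bigl (fun i : V => (enum_rank i < enum_rank v)%N)).
  by rewrite lerDl sumr_ge0.
move=> i; have [iv|] := boolP (enum_rank i < enum_rank v)%N; last by rewrite andbF.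
rewrite (ltn_trans iv vz)/= andbT; apply/eqP => E.
by rewrite E ltnn in iv.
Qed.

Let cumul1 u v : cumul P u v + P u v <= 1.
Proof.
rewrite -(tP.2 u) [leRHS](bigID (fun i => (enum_rank i < enum_rank v)%N))/=.
rewrite lerD2l (bigD1 v) ?ltnn//= lerDl; exact: sumr_ge0.
Qed.

Let jump_in u v x : cumul P u v <= x < cumul P u v + P u v ->
  jump P (u, x) = (v, (x - cumul P u v) / P u v).
Proof.
move=> /andP[vx xv]; rewrite /jump; case: pickP => /= [z /andP[zx xz]|/(_ v)]; last first.
  by rewrite vx xv.
suff -> : z = v by [].
apply: enum_rank_inj; apply/val_inj; apply/eqP; rewrite eqn_leq.
by apply/andP; split; rewrite leqNgt; apply/negP => /(cumul_lt u) h;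
  [have := le_lt_trans (le_trans h zx) xv|have := le_lt_trans (le_trans h vx) xz];
  rewrite ltxx.
Qed.

Let jump_out u x : (forall v, ~~ (cumul P u v <= x < cumul P u v + P u v)) ->
  jump P (u, x) = (u, x).
Proof.
by move=> h; rewrite /jump; case: pickP => //= z; rewrite (negbTE (h z)).
Qed.

Let jump_cover u (x : R) : 0 <= x < 1 ->
  exists v, cumul P u v <= x < cumul P u v + P u v.
Proof.
move=> /andP[x0 x1]; apply: contrapT => /forallNP h.
have H (n : nat) : forall v : V, (enum_rank v <= n)%N -> cumul P u v <= x.
  elim: n => [|n IH] v vn.
    rewrite /cumul big_pred0// => z; apply/negbTE; rewrite -leqNgt.
    by rewrite (leq_trans vn).
  move: vn; rewrite leq_eqVlt => /orP[/eqP vn|]; last exact: IH.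
  have nV : (n < #|V|)%N by rewrite (@ltn_trans n.+1)// -vn.
  set z := enum_val (Ordinal nV).
  have rz : enum_rank z = n :> nat by rewrite /z enum_valK.
  have -> : cumul P u v = cumul P u z + P u z.
    rewrite /cumul (bigD1 z)/=; last by rewrite rz vn.
    rewrite addrC; congr (_ + _); apply: eq_bigl => i.
    rewrite vn rz ltnS -(inj_eq (@enum_rank_inj V)) -(inj_eq val_inj)/= rz.
    by rewrite [RHS]ltn_neqAle andbC.
  rewrite leNgt; apply/negP => xz; apply: (h z).
  by rewrite xz andbT IH// rz.
have : \sum_(v : V) P u v <= x.
  have [v _|V0] := pickP (fun _ : V => true); last first.
    by rewrite big_pred0// (le_trans _ x0).
  have nV : (#|V|.-1 < #|V|)%N by rewrite prednK// (leq_ltn_trans _ (ltn_ord (enum_rank v))).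
  set z := enum_val (Ordinal nV).
  have rz : enum_rank z = #|V|.-1 :> nat by rewrite /z enum_valK.
  rewrite leNgt; apply/negP => xz; apply: (h z).
  rewrite (H #|V|.-1 z) ?rz//=; suff -> : cumul P u z + P u z = \sum_(v : V) P u v by [].
  rewrite /cumul [RHS](bigD1 z)//= addrC; congr (_ + _); apply: eq_bigl => i.
  rewrite rz -(inj_eq (@enum_rank_inj V)) -(inj_eq val_inj)/= rz ltn_neqAle.
  suff -> : (enum_rank i <= #|V|.-1)%N by rewrite andbT.
  by rewrite -ltnS prednK// (leq_ltn_trans _ nV).
by rewrite (tP.2 u) leNgt x1.
Qed.

Let chainS u t x : chain P u t.+1 x =
  let s := jump P (u, x) in chain P s.1 t s.2.
Proof. by rewrite /chain iterSr; case: (jump P (u, x)). Qed.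

Let path_itv t : forall y : nat -> V,
  let p := \prod_(s < t) P (y s) (y s.+1) in
  exists a : R, [/\ 0 <= a, a + p <= 1 & forall x : R, 0 <= x < 1 ->
    ((forall s, (s <= t)%N -> chain P (y 0%N) s x = y s) <-> a <= x < a + p)].
Proof.
elim: t => [|t IH] y p.
  exists 0; rewrite /p big_ord0 add0r lexx; split => // x ->; split => // _ s.
  by rewrite leqn0 => /eqP ->.
rewrite {}/p big_ord_recl/=.
have [a [a0 a1 H]] := IH (fun s => y s.+1).
set p := \prod_(s < t) _ in a1 H *.
have [Py|Py] := eqVneq (P (y 0%N) (y 1%N)) 0.
  exists 0; rewrite Py mul0r addr0; split => // x x01; split => [h|/andP[h1 h2]]; last first.
    by have := le_lt_trans h1 h2; rewrite ltxx.
  exfalso; have := h 1%N erefl.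
  have [v hv] := jump_cover (y 0%N) x01.
  rewrite chainS (jump_in hv)/= /chain/= => E; move: hv; rewrite E Py addr0.
  by move=> /andP[h1 h2]; have := le_lt_trans h1 h2; rewrite ltxx.
have Py0 : 0 < P (y 0%N) (y 1%N) by rewrite lt_def Py P0.
set q := P _ _ in Py Py0 *; set c := cumul P (y 0%N) (y 1%N).
have c0 : 0 <= c := cumul0 _ _.
have c1 : c + q <= 1 := cumul1 _ _.
have p0 : 0 <= p by apply: prodr_ge0.
exists (c + q * a); split.
- by rewrite addr_ge0// mulr_ge0// ltW.
- rewrite -addrA -mulrDr; apply: le_trans c1.
  by rewrite lerD2l ler_piMr// ltW.
move=> x x01.
have [v hv] := jump_cover (y 0%N) x01.
have in_ab z : (a <= (z - c) / q < a + p) = (c + q * a <= z < c + q * a + q * p).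
  rewrite ler_pdivlMr// ltr_pdivrMr// lerBrDr ltrBlDr.
  by rewrite ![_ * q]mulrC mulrDr [_ + c]addrC [_ + c]addrC addrA.
split => [h|h].
  have := h 1%N erefl; rewrite chainS (jump_in hv)/= /chain/= => E.
  rewrite -in_ab; apply/H.
    move: hv; rewrite E -/c -/q => /andP[h1 h2].
    rewrite divr_ge0 ?subr_ge0//=; last exact: ltW.
    by rewrite ltr_pdivrMr// mul1r ltrBlDr addrC.
  move=> s st; have := h s.+1 st; rewrite chainS (jump_in hv)/=.
  by rewrite E.
move: (h); rewrite -in_ab => h'.
have x01' : 0 <= (x - c) / q < 1.
  move: h' => /andP[h1 h2]; rewrite (le_trans a0 h1)/=; exact: lt_le_trans h2 a1.
have hx : c <= x < c + q.
  move: x01'; rewrite ler_pdivlMr// ltr_pdivrMr// mul0r mul1r subr_ge0.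
  by rewrite ltrBlDr addrC.
case=> [|s] st //; rewrite chainS (jump_in hx)/=.
exact: ((H _ x01').2 h' s st).
Qed.

Lemma chain_measurable t v : forall u, measurable (chain P u t @^-1` [set v]).
Proof.
elim: t => [|t IH] u.
  have [->|uv] := pselect (u = v).
    by rewrite (_ : _ @^-1` _ = setT)//; apply/seteqP; split.
  by rewrite (_ : _ @^-1` _ = set0)//; apply/seteqP; split.
pose I z : set R := `[cumul P u z, cumul P u z + P u z[%classic.
pose f z (x : R) := (x - cumul P u z) / P u z.
pose J z := I z `&` f z @^-1` (chain P z t @^-1` [set v]).
pose O := (~` \big[setU/set0]_(z : V) I z) `&` (chain P u t @^-1` [set v]).
have mI z : measurable (I z) by exact: measurable_itv.
have mJ z : measurable (J z).
  apply: measurableI => //; rewrite -[X in measurable X]setTI.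
  suff mf : measurable_fun setT (f z) by exact: mf.
  apply: (measurableT_comp (f := fun x : R => x / P u z)).
    exact: mulrr_measurable.
  exact: measurable_funB.
rewrite (_ : _ @^-1` _ = (\big[setU/set0]_(z : V) J z) `|` O).
  apply: measurableU; first exact: bigsetU_measurable.
  by apply: measurableI => //; apply: measurableC; exact: bigsetU_measurable.
have Iin z x : I z x -> cumul P u z <= x < cumul P u z + P u z.
  by rewrite /I/= in_itv.
apply/seteqP; split => x.
- rewrite /preimage/= chainS => h.
  have [[z hz]|/forallNP hz] := pselect (exists z, cumul P u z <= x < cumul P u z + P u z).
    left; move: h; rewrite (jump_in hz)/= => h.
    rewrite (bigD1 z)//=; left; split => //; by rewrite /I/= in_itv.
  right; split.
    by rewrite -bigcup_seq => -[z _ /Iin]; exact: hz.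
  by move: h; rewrite jump_out// => z; apply/negP; exact: hz.
- case=> [|[nI h]].
    rewrite -bigcup_seq => -[z _ [/Iin Iz h]].
    by rewrite /preimage/= chainS (jump_in Iz).
  rewrite /preimage/= chainS jump_out// => z; apply/negP => hz.
  by apply: nI; rewrite (bigD1 z)//=; left; rewrite /I/= in_itv.
Qed.

Local Notation U := (uniform_prob (@ltr01 R) : probability _ R).

Let history_measurable u y t : measurable (history (chain P u) y t).
Proof.
rewrite (_ : history _ _ _ =
    \bigcap_(s in [set k | (k <= t)%N]) (chain P u s @^-1` [set y s]))//.
by apply: bigcap_measurable => [|s _]; [exists 0%N|exact: chain_measurable].
Qed.

Lemma history_prob y t :
  U (history (chain P (y 0%N)) y t) = (\prod_(s < t) P (y s) (y s.+1))%:E.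
Proof.
have mH := history_measurable (y 0%N) y t.
have [a [a0 a1 H]] := path_itv t y.
set p := \prod_(s < t) _ in a1 H *.
have p0 : 0 <= p by apply: prodr_ge0.
have UE : U (history (chain P (y 0%N)) y t) =
    lebesgue_measure (history (chain P (y 0%N)) y t `&` `[0, 1]%classic).
  rewrite /= /uniform_prob integral_uniform_pdf.
  rewrite (eq_integral (fun=> 1%E)); last first.
    move=> x; rewrite inE => -[_]; rewrite /= in_itv/= /uniform_pdf => ->.
    by rewrite subr0 invr1.
  by rewrite integral_cst ?mul1e//; exact: measurableI.
have mp : lebesgue_measure (`[a, a + p[%classic : set R) = p%:E.
  rewrite lebesgue_measure_itv/= lte_fin ltrDl.
  by case: ltP => [_|p0']; [rewrite -EFinB addrC addKr|
    congr EFin; apply/eqP; rewrite eq_le p0 p0'].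
rewrite UE; apply/eqP; rewrite eq_le; apply/andP; split.
  have -> : p%:E = lebesgue_measure (`[a, a + p[%classic `|` [set (1 : R)]).
    by rewrite measureU0// ?mp//; exact: lebesgue_measure_set1.
  apply: le_measure; rewrite ?inE; [exact: measurableI|exact: measurableU|].
  move=> x [hx]; rewrite /= in_itv/= => /andP[x0].
  rewrite le_eqVlt => /orP[/eqP ->|x1]; first by right.
  by left; rewrite in_itv/=; apply/H => //; rewrite x0 x1.
rewrite -mp; apply: le_measure; rewrite ?inE//; first exact: measurableI.
move=> x; rewrite /= in_itv/= => hx.
have x01 : 0 <= x < 1.
  move: hx => /andP[h1 h2]; rewrite (le_trans a0 h1)/=; exact: lt_le_trans h2 a1.
split; first exact/(H x x01).
by move: x01 => /andP[h1 h2]; rewrite /= in_itv/= h1 ltW.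
Qed.

Lemma chain_random_walk u :
  random_walk (uniform_prob (@ltr01 R)) (fun=> P) (chain P u) /\
  (forall x, chain P u 0%N x = u).
Proof.
split => //; split => [t v|t y H0]; first exact: chain_measurable.
have y0 : y 0%N = u.
  apply: contrapT => y0; move/eqP: H0; apply.
  rewrite (_ : history _ _ _ = set0) ?measure0//.
  by apply/seteqP; split => // x /(_ 0%N erefl)/esym.
have HS : chain P u t.+1 @^-1` [set y t.+1] `&` history (chain P u) y t =
    history (chain P u) y t.+1.
  apply/seteqP; split => [x [h1 h2] s|x h].
    by rewrite leq_eqVlt => /orP[/eqP ->//|]; exact: h2.
  by split; [exact: h|move=> s st; exact/h/leqW].
rewrite /cprob HS; move: H0; rewrite -y0.
have -> := history_prob y t; have -> := history_prob y t.+1.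
rewrite big_ord_recr/= eqe => H0.
by rewrite mulrC mulKf.
Qed.

End ChainIsRandomWalk.

(* Main.v *)
Require Import Defs.
From HB Require Import structures.
From mathcomp Require Import all_boot all_order all_algebra.
From mathcomp Require Import all_classical all_reals all_analysis.
From mathcomp Require Import measurable_realfun ring lra zify.

(** The probability of avoiding w up to time T is <1, Q_T ... Q_1 1> in l2(pi),
    where Q_t is P_t killed at w: reversibility turns the forward evolution of
    the sub-distribution of X_t into the operators Q_t acting on densities with
    respect to pi. The expected hitting times h of w under P_t satisfy
    Q_t h = h - 1 <= (1 - 1 / t_hit) h away from w, so the Schur test with weight
    h bounds the l2(pi) norm of Q_t by 1 - 1 / t_hit. Cauchy-Schwarz then gives
    the first inequality, and 1 + x <= exp x the second. *)

Set Implicit Arguments.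
Unset Strict Implicit.
Unset Printing Implicit Defensive.

Import Order.TTheory GRing.Theory Num.Theory.
Import numFieldNormedType.Exports.

Local Open Scope classical_set_scope.
Local Open Scope ring_scope.

(** * Weighted Cauchy-Schwarz and the Schur test *)

(** The sum over [i], [j] of [p i * p j * (x i - x j) ^+ 2] is nonnegative, and it is twice the
    right side minus the left side. *)
Lemma sqr_wsum_le {R : realType} {I : finType} (p x : I -> R) :
  (forall i, 0 <= p i) ->
  (\sum_i p i * x i) ^+ 2 <= (\sum_i p i) * (\sum_i p i * x i ^+ 2).
Proof.
move=> p0; set S := \sum_i p i; set M := \sum_i _; set N := \sum_i _ * _ ^+ 2.
have : 0 <= \sum_i \sum_j p i * p j * (x i - x j) ^+ 2.
  do 2!apply: sumr_ge0 => ? _; apply: mulr_ge0; last exact: sqr_ge0.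
  exact: mulr_ge0.
have inner i : \sum_j p i * p j * (x i - x j) ^+ 2 =
    p i * x i ^+ 2 * S - 2 * M * (p i * x i) + N * p i.
  rewrite [2 * M * _]mulrAC [_ * M]mulrC [N * _]mulrC /S /M /N !mulr_sumr.
  by rewrite mulr_suml -sumrB -big_split/=; apply: eq_bigr => j _; ring.
under eq_bigr do rewrite inner.
rewrite big_split sumrB/= -mulr_suml -!mulr_sumr -/S -/M -/N.
lra.
Qed.

(** Only the row of [w] is erased; on functions vanishing at [w] this is the operator of the chain
    killed on entering [w]. *)
Definition kill {R : realType} {V : finType} (P : V -> V -> R) (w : V)
    (g : V -> R) (u : V) : R :=
  (u != w)%:R * \sum_v P u v * g v.

(* Schur test: Cauchy-Schwarz with weights P u v * h v, then symmetry of
   pi u * P u v. *)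
Lemma kill_schur {R : realType} {V : finType} (P : V -> V -> R) (pi : V -> R)
    (w : V) (h : V -> R) (lam : R) (f : V -> R) :
  (forall u v, 0 <= P u v) -> (forall v, 0 <= pi v) -> reversible pi P ->
  h w = 0 -> (forall u, u != w -> 0 < h u) ->
  0 <= lam -> (forall u, kill P w h u <= lam * h u) -> f w = 0 ->
  \sum_u pi u * kill P w f u ^+ 2 <= lam ^+ 2 * \sum_u pi u * f u ^+ 2.
Proof.
move=> P0 pi0 rev hw hpos lam0 hsup fw.
have h0 u : 0 <= h u by have [->|/hpos/ltW//] := eqVneq u w; rewrite hw.
pose q v := f v ^+ 2 / h v.
have q0 v : 0 <= q v by rewrite /q divr_ge0// sqr_ge0.
have point u : kill P w f u ^+ 2 <=
    lam * ((u != w)%:R * h u * \sum_v P u v * q v).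
  have [->|uw] := eqVneq u w; first by rewrite /kill eqxx !mul0r expr0n/= mulr0.
  have E : kill P w f u = \sum_v (P u v * h v) * (f v / h v).
    rewrite /kill uw mul1r; apply: eq_bigr => v _.
    have [->|/hpos hv] := eqVneq v w; first by rewrite fw hw !(mulr0, mul0r).
    by field; rewrite gt_eqF.
  rewrite E; apply: (le_trans (sqr_wsum_le _ _)) => [v|]; first exact: mulr_ge0.
  have -> : \sum_v P u v * h v * (f v / h v) ^+ 2 = \sum_v P u v * q v.
    apply: eq_bigr => v _; rewrite /q.
    have [->|/hpos hv] := eqVneq v w; first by rewrite fw hw expr0n/= !(mulr0, mul0r).
    by field; rewrite gt_eqF.
  rewrite mul1r mulrA ler_wpM2r//; first by apply: sumr_ge0 => v _; rewrite mulr_ge0.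
  by have := hsup u; rewrite /kill uw mul1r.
(* After summing [point] against [pi], detailed balance turns [pi u * P u v] into [pi v * P v u], so
   the sum over [u] rebuilds [kill P w h v], to which [hsup] applies a second time. *)
apply: (@le_trans _ _ (lam * \sum_v pi v * q v * kill P w h v)).
  apply: (@le_trans _ _ (\sum_u pi u * (lam * ((u != w)%:R * h u * \sum_v P u v * q v)))).
    by apply: ler_sum => u _; rewrite ler_wpM2l.
  rewrite le_eqVlt; apply/orP; left; apply/eqP.
  have E u : pi u * (lam * ((u != w)%:R * h u * \sum_v P u v * q v)) =
      lam * \sum_v pi v * q v * (P v u * h u).
    have -> : (u != w)%:R * h u = h u.
      by have [->|] := eqVneq u w; rewrite ?hw ?mulr0 ?mul1r.
    rewrite mulrCA; congr (_ * _); rewrite mulrA mulr_sumr.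
    apply: eq_bigr => v _.
    have -> : pi u * h u * (P u v * q v) = pi u * P u v * h u * q v by ring.
    by rewrite rev; ring.
  under eq_bigr do rewrite E.
  rewrite -mulr_sumr exchange_big/=; congr (_ * _); apply: eq_bigr => v _.
  rewrite -mulr_sumr /kill; have [->|] := eqVneq v w; last by rewrite mul1r.
  by rewrite /q hw invr0 !(mulr0, mul0r).
rewrite expr2 -mulrA ler_wpM2l// mulr_sumr; apply: ler_sum => v _.
apply: (@le_trans _ _ (pi v * q v * (lam * h v))).
  by rewrite ler_wpM2l// mulr_ge0.
rewrite le_eqVlt; apply/orP; left; apply/eqP; rewrite /q.
have [->|/hpos hv] := eqVneq v w; first by rewrite fw hw expr0n/= !(mulr0, mul0r).
by field; rewrite gt_eqF.
Qed.

(** * Forward evolution of the walk restricted to avoiding [w] *)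

Section Avoid.
Context {R : realType} {V : finType} {d : measure_display}
  {Omega : measurableType d}.
Variable Pr : probability Omega R.

Lemma fine_total_probability (I : finType) (Y : Omega -> I) (A : set Omega) :
  (forall i, measurable (Y @^-1` [set i])) -> measurable A ->
  fine (Pr A) = \sum_i fine (Pr (A `&` Y @^-1` [set i])).
Proof.
move=> mY mA.
rewrite {1}(_ : A = \bigcup_(i in [set: I]) (A `&` Y @^-1` [set i])); last first.
  by apply/seteqP; split=> [x Ax|x [i _ []//]]; exists (Y x).
rewrite measure_fin_bigcup//.
- rewrite (_ : [set: I] = [set` index_enum I]); last first.
    by apply/seteqP; split => // i _; rewrite /= mem_index_enum.
  rewrite -fsbig_seq ?index_enum_uniq// sum_fine// => i _.
  by rewrite fin_num_measure//; exact: measurableI.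
- exact: finite_finset.
- by move=> i j _ _ [x [[_ /= <-] [_ /= <-]]].
- by move=> i _; exact: measurableI.
Qed.

Variable X : nat -> Omega -> V.
Variable w : V.

Definition avoid (t : nat) : set Omega :=
  \bigcap_(s in [set s : nat | (s <= t)%N]) [set omega | X s omega <> w].

Definition mass (t : nat) (v : V) : R :=
  fine (Pr (avoid t `&` X t @^-1` [set v])).

Lemma mass_target t : mass t w = 0.
Proof.
rewrite /mass (_ : _ `&` _ = set0) ?measure0//.
by apply/seteqP; split => // x [h E]; exact: (h t (leqnn t) E).
Qed.

Hypothesis mX : forall t v, measurable (X t @^-1` [set v]).

Lemma measurable_avoid t : measurable (avoid t).
Proof.
apply: bigcap_measurable; first by exists 0%N.
by move=> s _; have /measurableC := mX s w.
Qed.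

Lemma measurable_history t y : measurable (history X y t).
Proof.
rewrite (_ : history _ _ _ =
  \bigcap_(s in [set k | (k <= t)%N]) (X s @^-1` [set y s]))//.
by apply: bigcap_measurable => [|s _]; [exists 0%N|exact: mX].
Qed.

Lemma fine_avoid t : fine (Pr (avoid t)) = \sum_v mass t v.
Proof. by apply: fine_total_probability => //; exact: measurable_avoid. Qed.

Lemma mass0 v : mass 0 v = (v != w)%:R * fine (Pr (X 0%N @^-1` [set v])).
Proof.
have [->|vw] := eqVneq v w; first by rewrite mass_target mul0r.
rewrite mul1r /mass; congr (fine (Pr _)); apply/seteqP; split => x; first by case.
move=> xv; split => // s; rewrite /= leqn0 => /eqP ->; rewrite xv.
exact/eqP.
Qed.

Variable P : nat -> V -> V -> R.
Hypothesis XP : random_walk Pr P X.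

(** Product form of the transition rule; it also covers histories of probability zero, where both
    sides vanish. *)
Lemma history_step t y :
  fine (Pr (X t.+1 @^-1` [set y t.+1] `&` history X y t)) =
  fine (Pr (history X y t)) * P t.+1 (y t) (y t.+1).
Proof.
have mH := measurable_history t y.
have [H0|H0] := eqVneq (Pr (history X y t)) 0%E.
  rewrite H0 mul0r (_ : Pr _ = 0%E)//; apply/eqP; rewrite eq_le measure_ge0 andbT.
  by rewrite -H0 le_measure ?inE//; exact: measurableI.
rewrite -(XP.2 _ _ H0) /cprob mulrC divfK//.
by rewrite fine_eq0// fin_num_measure.
Qed.

(** Avoidance and position at time [t] are determined by the history up to [t], so both events split
    into complete histories, and [history_step] handles each one. *)
Lemma mass_step t u v :
  fine (Pr (avoid t `&` X t @^-1` [set u] `&` X t.+1 @^-1` [set v])) =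
  mass t u * P t.+1 u v.
Proof.
pose Y x := [ffun s : 'I_t.+1 => X s x].
(* The value [v] beyond time [t] makes [ext y t.+1] the target of the step. *)
pose ext (y : {ffun 'I_t.+1 -> V}) s :=
  if (s <= t)%N then y (inord s) else v.
have YE y : Y @^-1` [set y] = history X (ext y) t.
  apply/seteqP; split => x.
    by move=> /= <- s st; rewrite /ext st ffunE inordK.
  move=> H; apply/ffunP => s; rewrite ffunE (H s) -1?ltnS// /ext -ltnS ltn_ord.
  by rewrite inord_val.
have mY y : measurable (Y @^-1` [set y]) by rewrite YE; exact: measurable_history.
have mA : measurable (avoid t `&` X t @^-1` [set u]).
  by apply: measurableI => //; exact: measurable_avoid.
have mB : measurable (avoid t `&` X t @^-1` [set u] `&` X t.+1 @^-1` [set v]).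
  exact: measurableI.
rewrite (fine_total_probability mY mB).
rewrite /mass (fine_total_probability mY mA) mulr_suml.
apply: eq_bigr => y _; rewrite YE setIAC.
set A := avoid t `&` _.
(* A history is either contained in [A] or disjoint from it. *)
have [sub|nsub] := pselect (history X (ext y) t `<=` A).
  have [[x Hx]|/forallNP H0] := pselect (exists x, history X (ext y) t x); last first.
    by rewrite (_ : history _ _ _ = set0) ?(setI0, set0I, measure0, mul0r)//;
      apply/seteqP; split => // x /H0.
  rewrite (setIidr sub) setIC.
  have -> : v = ext y t.+1 by rewrite /ext ltnn.
  rewrite history_step; congr (_ * P _ _ _).
  by rewrite -(Hx t (leqnn t)); case: (sub _ Hx).
suff -> : A `&` history X (ext y) t = set0 by rewrite set0I measure0 mul0r.
apply/seteqP; split => // x [[Ax Xx] Hx]; apply: nsub => z Hz; split.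
  by move=> s st; rewrite /= (Hz s st) -(Hx s st); exact: Ax.
by rewrite /preimage/= (Hz t (leqnn t)) -(Hx t (leqnn t)).
Qed.

Lemma massS t v :
  mass t.+1 v = (v != w)%:R * \sum_u mass t u * P t.+1 u v.
Proof.
have [->|vw] := eqVneq v w; first by rewrite mass_target mul0r.
rewrite mul1r /mass.
have -> : avoid t.+1 `&` X t.+1 @^-1` [set v] = avoid t `&` X t.+1 @^-1` [set v].
  apply/seteqP; split => x [h1 h2]; split => // s.
    by move=> st; apply: h1; exact: leqW.
  rewrite /= leq_eqVlt => /orP[/eqP ->|]; last exact: h1.
  by rewrite h2; exact/eqP.
rewrite (fine_total_probability (mX t)); last first.
  by apply: measurableI => //; exact: measurable_avoid.
by apply: eq_bigr => u _; rewrite -mass_step setIAC.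
Qed.

End Avoid.

(** * Lower bounds on integrals by simple functions *)

Section IntegralSimpleBound.
Import HBNNSimple.

(* Unlike ge0_le_integral, this asks no measurability of f, so that of the
   hitting time need not be established. *)
Lemma le_integral_nnsfun {R : realType} {d : measure_display} {T : measurableType d}
    (mu : {measure set T -> \bar R}) (h : {nnsfun T >-> R}) (f : T -> \bar R) :
  (forall x, (h x)%:E <= f x)%E ->
  (\int[mu]_x (h x)%:E <= \int[mu]_x f x)%E.
Proof.
move=> hf.
have f0 x : (0 <= f x)%E by apply: le_trans (hf x); rewrite lee_fin.
rewrite !ge0_integralTE// => [|x]; last by rewrite lee_fin.
apply: le_ereal_sup => _ [g gh <-]; exists g => // x.
exact: le_trans (gh x) (hf x).
Qed.

Lemma sum_measure_le_integral {R : realType} {d : measure_display}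
    {T : measurableType d} (mu : {measure set T -> \bar R}) (A : nat -> set T)
    (n : nat) (f : T -> \bar R) :
  (forall t, measurable (A t)) ->
  (forall x, (\sum_(t < n) \1_(A t) x)%:E <= f x)%E ->
  (\sum_(t < n) mu (A t) <= \int[mu]_x f x)%E.
Proof.
move=> mA Af; pose h := sum_nnsfun (fun t => indic_nnsfun R (mA t)) n.
have hE x : h x = \sum_(t < n) \1_(A t) x by rewrite sum_nnsfunE.
have -> : (\sum_(t < n) mu (A t) = \int[mu]_x (h x)%:E)%E.
  under eq_integral do rewrite hE -sumEFin.
  rewrite ge0_integral_sum//; last first.
    by move=> t; apply/measurable_EFinP; exact: measurable_indic.
  by apply: eq_bigr => t _; rewrite integral_indic// setIT.
by apply: le_integral_nnsfun => x; rewrite hE.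
Qed.

End IntegralSimpleBound.

(** * Survival probabilities and hitting times for a single matrix *)

Section HomogeneousSurvival.
Context {R : realType} {V : finType}.
Variables (P : V -> V -> R) (w : V).

Definition surv (t : nat) : V -> R := iter t (kill P w) (fun u => (u != w)%:R).

Lemma surv_target t : surv t w = 0.
Proof. by case: t => [|t]; rewrite /surv /= ?/kill eqxx ?mul0r. Qed.

Lemma sum_mass_iter {d : measure_display} {Omega : measurableType d}
    (Pr : probability Omega R) (X : nat -> Omega -> V) (g : V -> R) t :
  random_walk Pr (fun=> P) X -> g w = 0 ->
  \sum_v mass Pr X w t v * g v =
  \sum_v mass Pr X w 0 v * iter t (kill P w) g v.
Proof.
move=> XP; elim: t g => [//|t IH] g gw.
rewrite iterSr -IH; last by rewrite /kill eqxx mul0r.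
under eq_bigr do rewrite (massS w XP.1 XP) -mulrA mulr_suml mulr_sumr.
rewrite exchange_big/=; apply: eq_bigr => u _; rewrite /kill.
have [->|_] := eqVneq u w.
  by rewrite mass_target mul0r big1// => v _; rewrite !mul0r mulr0.
rewrite mul1r mulr_sumr; apply: eq_bigr => v _.
by have [->|_] := eqVneq v w; rewrite ?gw ?mulr0// mul1r mulrA.
Qed.

Hypothesis tP : transition_matrix P.

Let U : probability _ R := uniform_prob (@ltr01 R).

Lemma fine_avoid_chain u t : fine (U (avoid (chain P u) w t)) = surv t u.
Proof.
have [XP X0] := chain_random_walk tP u.
rewrite (fine_avoid _ _ XP.1).
have -> : \sum_v mass U (chain P u) w t v =
    \sum_v mass U (chain P u) w t v * (v != w)%:R.
  apply: eq_bigr => v _; have [->|_] := eqVneq v w; last by rewrite mulr1.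
  by rewrite mass_target mul0r.
rewrite (sum_mass_iter _ XP) ?eqxx// -/(surv t) (bigD1 u)//= big1 => [|v vu].
  rewrite addr0 mass0 (_ : _ @^-1` _ = setT) ?probability_setT; last first.
    by apply/seteqP; split => // x _; exact: X0.
  by rewrite mulr1; have [->|_] := eqVneq u w; rewrite ?surv_target ?mulr0// mul1r.
rewrite mass0 (_ : _ @^-1` _ = set0) ?measure0 ?mulr0 ?mul0r//.
by apply/seteqP; split => // x /= E; move: vu; rewrite -E X0 eqxx.
Qed.

(** Truncated tail-sum formula: the hitting time dominates the number of [t < n] at which [w] is
    still unvisited. *)
Lemma sum_surv_le_expected_hit n u :
  ((\sum_(t < n) surv t u)%:E <= expected_hit P u w)%E.
Proof.
have [XP X0] := chain_random_walk tP u.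
have -> : (\sum_(t < n) surv t u)%:E = (\sum_(t < n) U (avoid (chain P u) w t))%E.
  rewrite -sumEFin; apply: eq_bigr => t _; rewrite -fine_avoid_chain fineK//.
  by rewrite fin_num_measure//; exact: (measurable_avoid w XP.1).
apply: sum_measure_le_integral => [t|x]; first exact: (measurable_avoid w XP.1).
apply: le_ereal_inf_tmp => _ [t0 /= xt0 <-]; rewrite lee_fin.
(* With a visit at [t0], avoidance up to [t] forces [t < t0]; at most [minn n t0] indices remain. If
   [w] is never visited the infimum is [+oo] and there is no [t0] to treat. *)
apply: (@le_trans _ _ (\sum_(t < n) (t < t0)%N%:R)).
  apply: ler_sum => t _; rewrite indicE; have [|t0t] := ltnP t t0.
    by move=> _; case: (_ \in _).
  by rewrite memNset// => /(_ t0 t0t).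
rewrite -natr_sum ler_nat; apply: (@leq_trans (minn n t0)); last exact: geq_minr.
elim: n => [|n IH]; first by rewrite big_ord0.
by rewrite big_ord_recr/=; move: IH; case: ltnP => /=; lia.
Qed.

Lemma expected_hit_le_t_hit u : (expected_hit P u w <= t_hit P)%E.
Proof.
apply: le_trans (le_bigmax _ _ u).
exact: (le_bigmax _ (fun w => expected_hit P u w) w).
Qed.

Lemma surv_ge0 t u : 0 <= surv t u.
Proof. by rewrite -fine_avoid_chain fine_ge0. Qed.

(** First-step analysis; letting [n] grow gives the equation [h = 1 + kill P w h] away from [w]. *)
Lemma sum_survS n u :
  \sum_(t < n.+1) surv t u =
  (u != w)%:R + kill P w (fun v => \sum_(t < n) surv t v) u.
Proof.
rewrite big_ord_recl/=; congr (_ + _); rewrite /kill.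
under [in RHS]eq_bigr do rewrite mulr_sumr.
by rewrite exchange_big/= mulr_sumr.
Qed.

Hypothesis tfin : (t_hit P < +oo)%E.

Lemma t_hit_fin_num : t_hit P \is a fin_num.
Proof.
rewrite ge0_fin_numE//; apply: le_trans (expected_hit_le_t_hit w).
by apply: le_trans (sum_surv_le_expected_hit 0 w); rewrite big_ord0.
Qed.

(* The h constructed here is the expected hitting time of w, as the limit of the
   sums of the first n survival probabilities. *)
Lemma killed_poisson : exists h : V -> R,
  [/\ h w = 0, forall u, 0 <= h u <= fine (t_hit P) &
      forall u, u != w -> h u = 1 + kill P w h u].
Proof.
pose S n u := \sum_(t < n) surv t u.
have SH n u : S n u <= fine (t_hit P).
  rewrite -lee_fin fineK ?t_hit_fin_num//.
  exact: le_trans (sum_surv_le_expected_hit n u) (expected_hit_le_t_hit u).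
have Sc u : cvgn (S ^~ u).
  apply: nondecreasing_is_cvgn.
    apply/nondecreasing_seqP => n; rewrite /S big_ord_recr/= lerDl.
    exact: surv_ge0.
  by exists (fine (t_hit P)) => _ [n _ <-].
exists (fun u => limn (S ^~ u)); split.
- apply: lim_near_cst => //; near=> n.
  by rewrite /S big1// => t _; exact: surv_target.
- move=> u; rewrite limr_ge ?limr_le//; near=> n => //.
  by apply: sumr_ge0 => t _; exact: surv_ge0.
- move=> u uw; apply: cvg_lim => //; rewrite -cvg_shiftS/=.
  under eq_cvg do rewrite /S sum_survS uw /kill uw mul1r.
  rewrite /kill uw mul1r; apply: cvgD; first exact: cvg_cst.
  apply: cvg_big => [|v _]; first exact: add_continuous.
  by apply: cvgM; [exact: cvg_cst|exact: Sc].
Unshelve. all: by end_near. Qed.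

Hypothesis hV : (2 <= #|V|)%N.

(** A vertex other than [w] needs at least one step to reach it. This makes the factor
    [1 - 1 / t_hit] nonnegative, as the Schur test requires. *)
Lemma t_hit_ge1 : 1 <= fine (t_hit P).
Proof.
have [h [_ hH hE]] := killed_poisson.
have [u uw] : exists u, u != w.
  apply: contrapT => /forallNP nw; move: hV; rewrite leqNgt ltnS; apply/negP/negPn.
  by rewrite -(card1 w); apply: subset_leq_card; apply/fintype.subsetP => u _;
    rewrite inE; apply/negPn/negP/nw.
apply: le_trans (proj2 (andP (hH u))); rewrite hE// lerDl mulr_ge0//.
apply: sumr_ge0 => v _; apply: mulr_ge0; last by case/andP: (hH v).
by have /andP[] := tP.1 u v.
Qed.

Lemma kill_contract (pi f : V -> R) :
  (forall v, 0 <= pi v) -> reversible pi P -> f w = 0 ->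
  \sum_u pi u * kill P w f u ^+ 2 <=
  (1 - (fine (t_hit P))^-1) ^+ 2 * \sum_u pi u * f u ^+ 2.
Proof.
move=> pi0 rev fw; have [h [hw hH hE]] := killed_poisson.
have P0 u v : 0 <= P u v by have /andP[] := tP.1 u v.
have h0 u : 0 <= h u by case/andP: (hH u).
have kh0 u : 0 <= kill P w h u.
  by rewrite mulr_ge0//; apply: sumr_ge0 => v _; exact: mulr_ge0.
have H1 := t_hit_ge1; have H0 := lt_le_trans ltr01 H1.
apply: (kill_schur (h := h)) => //.
- by move=> u uw; rewrite hE// ltr_pwDl.
- by rewrite subr_ge0 invf_le1.
- move=> u; have [->|uw] := eqVneq u w; first by rewrite /kill eqxx mul0r hw mulr0.
  (* As [h u = 1 + kill P w h u], the claim reduces to [h u] divided by [t_hit P] being at most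
     1. *)
  rewrite mulrBl mul1r lerBrDr [leLHS]addrC [leRHS]hE// lerD2r.
  by rewrite mulrC ler_pdivrMr// mul1r; case/andP: (hH u).
Qed.

End HomogeneousSurvival.

(** * Densities with respect to [pi] and the two inequalities *)

(** Detailed balance moves [pi] across each transition, so the density of [mass] relative to [pi]
    evolves by [kill], with the earliest step applied first. *)
Lemma mass_reversible {R : realType} {V : finType} {d : measure_display}
    {Omega : measurableType d} (Pr : probability Omega R) (X : nat -> Omega -> V)
    (P : nat -> V -> V -> R) (pi : V -> R) (w : V) (f : nat -> V -> R) :
  random_walk Pr P X ->
  (forall t, (1 <= t)%N -> reversible pi (P t)) ->
  (forall v, Pr (X 0%N @^-1` [set v]) = (pi v)%:E) ->
  (f 0%N = fun v => (v != w)%:R) ->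
  (forall t, f t.+1 = kill (P t.+1) w (f t)) ->
  forall t v, mass Pr X w t v = pi v * f t v.
Proof.
move=> XP rev X0 f0 fS; elim=> [|t IH] v.
  by rewrite mass0 X0 f0 mulrC.
rewrite (massS w XP.1 XP) fS /kill mulrCA; congr (_ * _).
rewrite mulr_sumr; apply: eq_bigr => u _.
by rewrite IH mulrAC rev// mulrA.
Qed.

Theorem lemma1p11 (R : realType) (V : finType) (hV : (2 <= #|V|)%N)
    (P : nat -> V -> V -> R) (pi : V -> R)
    (Ptrans : forall t, (1 <= t)%N -> transition_matrix (P t))
    (Pirr : forall t, (1 <= t)%N -> irreducible (P t))
    (Pstat : forall t, (1 <= t)%N -> stationary pi (P t))
    (Prev : forall t, (1 <= t)%N -> reversible pi (P t))
    (tHIT_fin : (t_HIT P < +oo)%E)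
    (d : measure_display) (Omega : measurableType d)
    (Pr : probability Omega R) (X : nat -> Omega -> V)
    (XP : random_walk Pr P X)
    (X0 : forall v, Pr (X 0%N @^-1` [set v]) = (pi v)%:E)
    (w : V) (T : nat) :
  (Pr (\bigcap_(t in [set t : nat | (t <= T)%N])
         [set omega | X t omega <> w])
     <= (\prod_(1 <= t < T.+1) (1 - (fine (t_hit (P t)))^-1))%:E)%E /\
  \prod_(1 <= t < T.+1) (1 - (fine (t_hit (P t)))^-1)
    <= expR (- (T%:R / fine (t_HIT P))).
Proof.
have leHIT t : (1 <= t)%N -> (t_hit (P t) <= t_HIT P)%E.
  by move=> t1; apply: ereal_sup_ubound; exists t.
have tfin t : (1 <= t)%N -> (t_hit (P t) < +oo)%E.
  by move=> t1; exact: le_lt_trans (leHIT t t1) tHIT_fin.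
have H1 t : (1 <= t)%N -> 1 <= fine (t_hit (P t)).
  by move=> t1; apply: (t_hit_ge1 w); [exact: Ptrans|exact: tfin|].
pose lam t := 1 - (fine (t_hit (P t)))^-1.
have lam0 t : (1 <= t)%N -> 0 <= lam t.
  move=> t1; have H := H1 t t1.
  by rewrite subr_ge0 invf_le1//; exact: lt_le_trans H.
have [pi0 pi1 _] := Pstat 1%N erefl.
split.
  pose f := fix f t := if t is s.+1 then kill (P s.+1) w (f s)
                       else fun v => (v != w)%:R : R.
  have fw t : f t w = 0 by case: t => [|t]; rewrite /= ?/kill eqxx ?mul0r.
  have norm t : \sum_u pi u * f t u ^+ 2 <= (\prod_(1 <= s < t.+1) lam s) ^+ 2.
    elim: t => [|t IH].
      rewrite big_geq// expr1n -pi1; apply: ler_sum => u _.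
      by rewrite ler_piMr//=; case: (u == w); rewrite /= ?expr0n ?expr1n.
    rewrite big_nat_recr//= exprMn mulrC.
    apply: le_trans (ler_wpM2l (sqr_ge0 _) IH).
    by apply: kill_contract => //; [exact: Ptrans|exact: tfin|exact: Prev].
  have lamT : 0 <= \prod_(1 <= s < T.+1) lam s.
    by rewrite big_nat_cond; apply: prodr_ge0 => s /andP[/andP[s1 _] _]; exact: lam0.
  rewrite -[leLHS]fineK; last by rewrite fin_num_measure//; exact: (measurable_avoid w XP.1).
  rewrite lee_fin -/(avoid X w T) (fine_avoid Pr w XP.1).
  have massE := mass_reversible (w := w) (f := f) XP Prev X0 erefl (fun=> erefl) T.
  rewrite (eq_bigr _ (fun v _ => massE v)).
  (* Passing to the absolute value allows squaring; Cauchy-Schwarz with weights [pi] of total mass 1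
     then leaves exactly [norm]. *)
  apply: le_trans (ler_norm _) _.
  rewrite -ler_sqr ?nnegrE// real_normK ?num_real//.
  by apply: le_trans (sqr_wsum_le _ pi0) _; rewrite pi1 mul1r.
have HITfin : t_HIT P \is a fin_num.
  rewrite ge0_fin_numE//; apply: le_trans (leHIT 1%N erefl).
  rewrite -[leRHS]fineK; last by apply: (t_hit_fin_num w); [exact: Ptrans|exact: tfin].
  by rewrite lee_fin (le_trans ler01)// H1.
have hitHIT t : (1 <= t)%N -> fine (t_hit (P t)) <= fine (t_HIT P).
  move=> t1; rewrite -lee_fin !fineK ?leHIT//.
  by apply: (t_hit_fin_num w); [exact: Ptrans|exact: tfin].
have hit0 t : (1 <= t)%N -> 0 < fine (t_hit (P t)).
  by move=> t1; exact: lt_le_trans ltr01 (H1 t t1).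
have -> : expR (- (T%:R / fine (t_HIT P))) =
    \prod_(1 <= t < T.+1) expR (- (fine (t_HIT P))^-1).
  by rewrite prodr_const_nat subn1 -expRM_natl mulrN.
rewrite big_nat_cond [leRHS]big_nat_cond.
apply: ler_prod => t /andP[/andP[t1 _] _]; rewrite lam0//=.
(* Here [1 + x <= expR x] is used at [x = - 1 / t_hit (P t)], and [t_hit (P t) <= t_HIT P]
   finishes. *)
apply: le_trans (expR_ge1Dx _) _; rewrite ler_expR lerN2.
by rewrite lef_pV2 ?hitHIT// posrE ?(lt_le_trans _ (hitHIT t t1)) ?hit0.
Qed.
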